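(* Let $w(x;q^\nu\mid q)$, $H_q^\nu$, $C_n(x;q^\nu|q)$, $J_{\nu+n}(\cdot\,;q)$ and $K_q^\nu$ be as in the context. Let $f$ be a function of the form $$f(t)=\int_{-1}^{1}u(x)K_q^\nu(x,t)\,w(x;q^\nu\mid q)\,dx$$ where $u\in H_q^\nu$. Then $f$ can be written as $$f(t)=\sum_{n=0}^{\infty}a_n\,J_{\nu+n}(t;q)$$ with the coefficients $a_n$ given by $$a_n=i^n\,\frac{1-q^{n+\nu}}{1-q^{\nu}}\sqrt{\frac{(q;q)_n}{(q^{2\nu};q)_n}}\int_{-1}^{1}u(x)\,C_n(x;q^\nu|q)\,w(x;q^\nu\mid q)\,dx .$$
   Context: Here $0<q<1$ and $\nu$ is the order parameter. Notation: $(a;q)_n=\prod_{j=0}^{n-1}(1-aq^j)$, $(a;q)_\infty=\prod_{j\ge0}(1-aq^j)$, $(a_1,\dots,a_m;q)_\infty=\prod_i(a_i;q)_\infty$. The continuous $q$-ultraspherical polynomials are $$C_n(\cos\theta;\beta|q)=\sum_{j=0}^n\frac{(\beta;q)_j(\beta;q)_{n-j}}{(q;q)_j(q;q)_{n-j}}e^{i(n-2j)\theta}.$$ They satisfy $$\int_{-1}^1C_n(x;q^\nu|q)C_m(x;q^\nu|q)w(x;q^\nu\mid q)\,dx=\frac{(1-q^\nu)(q^{2\nu};q)_n}{(1-q^{n+\nu})(q;q)_n}\delta_{mn},$$ where, for $\beta=q^\nu$ and $0<\theta<\pi$, $$w(\cos\theta;\beta\mid q)=\frac{(q,q^{2\nu};q)_\infty\,(e^{2i\theta},e^{-2i\theta};q)_\infty}{2\pi\sin\theta\,(q^\nu,q^{\nu+1};q)_\infty\,(\beta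 e^{2i\theta},\beta e^{-2i\theta};q)_\infty}.$$ $H_q^\nu=L^2[(-1,1),w(x;q^\nu\mid q)]$. The second Jackson $q$-Bessel function of order $\nu$ is $$J_\nu(x;q)=\frac{(q^{\nu+1};q)_\infty}{(q;q)_\infty}\sum_{n=0}^\infty(-1)^n\frac{(x/2)^{\nu+2n}}{(q;q)_n(q^{\nu+1};q)_n}q^{n(\nu+n)}.$$ The kernel is $$K_q^\nu(x,t)=\sum_{k=0}^\infty i^kq^{k(2\nu+k-1)/4}\frac{1-q^{k+\nu}}{1-q^\nu}\sqrt{\frac{(q;q)_k}{(q^{2\nu};q)_k}}\;J_{\nu+k}(2t;q)\,C_k(x;q^\nu|q).$$
   Formalization: The printed expansion is false (u=1 gives J_ν(2t;q)=J_ν(t;q)); what is proved is f(t)=∑ a_n q^{n(2ν+n−1)/4} J_{ν+n}(2t;q), with a_n as printed, restoring the kernel's two dropped factors, for ν>0 and real t≥0. *)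

(* Defs.v *)
From HB Require Import structures.
From mathcomp Require Import all_boot all_order all_algebra.
From mathcomp Require Import all_classical all_reals all_analysis.
From mathcomp Require Export complex.

Set Implicit Arguments.
Unset Strict Implicit.
Unset Printing Implicit Defensive.

Import Order.TTheory GRing.Theory Num.Theory.
Import numFieldNormedType.Exports.

Local Open Scope classical_set_scope.
Local Open Scope ring_scope.
Local Open Scope complex_scope.

Section NumField.
Variables (K : numFieldType) (q : K).

Definition qpoch (a : K) (n : nat) : K := \prod_(j < n) (1 - a * q ^+ j).

Definition qpoch_inf (a : K) : K := limn (qpoch a).

(* Named over an abstract numFieldType so that they also apply to R[i], whose
   topology is the one of its norm. *)
Definition series_sum (a : nat -> K) : K := limn (series a).

Definition series_cvg_to (a : nat -> K) (s : K) : Prop :=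
  series a @ \oo --> s.

End NumField.

Section QUltraspherical.
Variable R : realType.
Implicit Types (q nu x t theta : R) (n : nat).

Definition cis theta : R[i] := cos theta +i* sin theta.

(* C_n(x; beta | q) at x = cos theta, with theta = acos x in [0, pi]. *)
Definition qultra (beta q : R) n x : R[i] :=
  \sum_(j < n.+1)
    ((qpoch q beta j * qpoch q beta (n - j)) /
     (qpoch q q j * qpoch q q (n - j)))%:C *
    cis ((n%:R - j%:R *+ 2) * acos x).

(* w(x; q^nu | q) at x = cos theta, 0 < theta < pi.  The formula lives in
   R[i], but its value is real since the factors at e^{2i theta} and
   e^{-2i theta} are complex conjugate; [Re] only changes its type. *)
Definition qweight q nu x : R :=
  let theta := acos x in
  let beta := q `^ nu in
  let e := cis (theta *+ 2) in
  let e' := cis (- (theta *+ 2)) in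
  complex.Re
    ((qpoch_inf q q * qpoch_inf q (q `^ (nu *+ 2)))%:C *
     (qpoch_inf q%:C e * qpoch_inf q%:C e') /
     ((pi *+ 2 * sin theta *
       (qpoch_inf q (q `^ nu) * qpoch_inf q (q `^ (nu + 1))))%:C *
      (qpoch_inf q%:C (beta%:C * e) * qpoch_inf q%:C (beta%:C * e')))).

(* Second Jackson q-Bessel function of real order nu, for x >= 0. *)
Definition qbessel q nu x : R :=
  qpoch_inf q (q `^ (nu + 1)) / qpoch_inf q q *
  series_sum (fun n =>
    (-1) ^+ n * (x / 2) `^ (nu + n%:R *+ 2) /
    (qpoch q q n * qpoch q (q `^ (nu + 1)) n) *
    q `^ (n%:R * (nu + n%:R))).

Definition qkernel q nu x t : R[i] :=
  series_sum (fun k =>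
    'i%C ^+ k *
    (q `^ (k%:R * (nu *+ 2 + k%:R - 1) / 4) *
     ((1 - q `^ (k%:R + nu)) / (1 - q `^ nu)) *
     Num.sqrt (qpoch q q k / qpoch q (q `^ (nu *+ 2)) k) *
     qbessel q (nu + k%:R) (t *+ 2))%:C *
    qultra (q `^ nu) q k x).

Local Notation I11 := (`]-1, 1[%classic : set R).

Definition cintegral (f : R -> R[i]) : R[i] :=
  Rintegral lebesgue_measure I11 (fun x => complex.Re (f x)) +i*
  Rintegral lebesgue_measure I11 (fun x => complex.Im (f x)).

(* Complex-valued representatives of L^2[(-1,1), w(x; q^nu | q) dx]. *)
Definition in_H q nu (u : R -> R[i]) : Prop :=
  [/\ measurable_fun I11 (fun x => complex.Re (u x)),
      measurable_fun I11 (fun x => complex.Im (u x)) &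
      (\int[lebesgue_measure]_(x in I11)
         (Normc.normc (u x) ^+ 2 * qweight q nu x)%:E < +oo)%E].

End QUltraspherical.

(* Main.v *)
(** The kernel is the sum of [kernel_coef t k * qultra k x].  The polynomials
    are bounded on (-1,1) by a multiple of k+1, the q-Bessel functions grow at
    most geometrically in the order, and q^(k(2nu+k-1)/4) decays like a
    Gaussian, so the partial sums of the kernel are bounded uniformly in x.
    The weight equals |(e^(2i theta))_oo|^2 / sin theta up to factors bounded
    above and below; since |1 - e^(2i theta)|^2 = 4 sin^2 theta it is a bounded
    function, hence u in L^2(w) makes u w integrable and dominated convergence
    exchanges the sum with the integral. *)

Require Import Defs.
From mathcomp Require Import all_boot all_order all_algebra.
From mathcomp Require Import all_classical all_reals all_analysis.
From mathcomp Require Import complex measurable_realfun ring lra.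

Import Order.TTheory GRing.Theory Num.Theory.
Import numFieldNormedType.Exports.

Local Open Scope classical_set_scope.
Local Open Scope ring_scope.
Local Open Scope complex_scope.

(** * Limits and series in [R[i]] through real and imaginary parts *)

Section ComplexLimits.
Context {R : realType}.
Local Notation C := (R[i] : numFieldType).
Implicit Types (z : nat -> C) (l : C).

Lemma normc_ge0 (x : R[i]) : 0 <= Normc.normc x.
Proof. by case: x => a b; exact: sqrtr_ge0. Qed.

Lemma normc_le_ReIm (x : R[i]) : Normc.normc x <= `|complex.Re x| + `|complex.Im x|.
Proof.
case: x => a b /=.
rewrite -(ler_pXn2r (_ : (0 < 2)%N)) ?nnegrE ?addr_ge0 ?sqrtr_ge0 //.
rewrite sqr_sqrtr ?addr_ge0 ?sqr_ge0 // sqrrD !real_normK ?num_real //.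
by rewrite lerD2r lerDl mulrn_wge0 // mulr_ge0.
Qed.

Lemma Re_le_normc (x : R[i]) : `|complex.Re x| <= Normc.normc x.
Proof.
case: x => a b /=; rewrite -sqrtr_sqr ler_wsqrtr // lerDl sqr_ge0 //.
Qed.

Lemma Im_le_normc (x : R[i]) : `|complex.Im x| <= Normc.normc x.
Proof.
case: x => a b /=; rewrite -sqrtr_sqr ler_wsqrtr // lerDr sqr_ge0 //.
Qed.

Lemma cvg_ReIm z l :
  complex.Re (z n) @[n --> \oo] --> complex.Re l ->
  complex.Im (z n) @[n --> \oo] --> complex.Im l -> z @ \oo --> l.
Proof.
move=> /cvgrPdist_lt zr /cvgrPdist_lt zi; apply/cvgrPdist_lt => e e0.
(* In the partial order of [R[i]] a positive element is real, so the tolerance may be halved in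
   [R]. *)
have ->: e = (complex.Re e)%:C by rewrite RRe_real // ger0_real // ltW.
have e2 : 0 < complex.Re e / 2.
  by rewrite divr_gt0 //; move: e0; rewrite ltcE => /andP[].
have ? := zr _ e2; have ? := zi _ e2.
near=> n.
rewrite ltcR; apply: (le_lt_trans (normc_le_ReIm _)).
rewrite (splitr (complex.Re e)) ltrD //.
- have -> : complex.Re (l - z n) = complex.Re l - complex.Re (z n).
    by case: (l) (z n) => ? ? [].
  by near: n.
- have -> : complex.Im (l - z n) = complex.Im l - complex.Im (z n).
    by case: (l) (z n) => ? ? [].
  by near: n.
Unshelve. all: by end_near. Qed.

Lemma cvg_Re_Im z l : z @ \oo --> l ->
  complex.Re (z n) @[n --> \oo] --> complex.Re l /\
  complex.Im (z n) @[n --> \oo] --> complex.Im l.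
Proof.
move=> /cvgrPdist_lt zl; split; apply/cvgrPdist_lt => e e0.
- have e0' : 0 < e%:C by rewrite ltcR.
  have ? := zl _ e0'.
  near=> n.
  have -> : complex.Re l - complex.Re (z n) = complex.Re (l - z n).
    by case: (l) (z n) => ? ? [].
  apply: (le_lt_trans (Re_le_normc _)); rewrite -ltcR; by near: n.
- have e0' : 0 < e%:C by rewrite ltcR.
  have ? := zl _ e0'.
  near=> n.
  have -> : complex.Im l - complex.Im (z n) = complex.Im (l - z n).
    by case: (l) (z n) => ? ? [].
  apply: (le_lt_trans (Im_le_normc _)); rewrite -ltcR; by near: n.
Unshelve. all: by end_near. Qed.

Lemma Re_sum I (r : seq I) (P : pred I) (F : I -> R[i]) :
  complex.Re (\sum_(i <- r | P i) F i) = \sum_(i <- r | P i) complex.Re (F i).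
Proof. by apply: (big_morph (@complex.Re R)) => [[? ?] [? ?]|]. Qed.

Lemma Im_sum I (r : seq I) (P : pred I) (F : I -> R[i]) :
  complex.Im (\sum_(i <- r | P i) F i) = \sum_(i <- r | P i) complex.Im (F i).
Proof. by apply: (big_morph (@complex.Im R)) => [[? ?] [? ?]|]. Qed.

(** [series_sum] is a [limn], which by itself does not assert convergence. The real and the
    imaginary series are both dominated by [b], so they converge absolutely in [R]; uniqueness of
    limits then identifies the value. *)
Lemma series_cvg_to_sum z (b : nat -> R) :
  (forall n, Normc.normc (z n) <= b n) -> cvgn (series b) ->
  series_cvg_to z (series_sum z).
Proof.
move=> zb cb; rewrite /series_cvg_to /series_sum.
have [lr hr] : exists l : R, series (fun n => complex.Re (z n)) @ \oo --> l.
  apply/cvg_ex; apply: normed_cvg; apply: series_le_cvg cb => n /=;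
    rewrite ?normr_ge0 //.
    exact: le_trans (normc_ge0 _) (zb n).
  exact: le_trans (Re_le_normc _) (zb n).
have [li hi] : exists l : R, series (fun n => complex.Im (z n)) @ \oo --> l.
  apply/cvg_ex; apply: normed_cvg; apply: series_le_cvg cb => n /=;
    rewrite ?normr_ge0 //.
    exact: le_trans (normc_ge0 _) (zb n).
  exact: le_trans (Im_le_normc _) (zb n).
suff h : series z @ \oo --> (lr +i* li : C).
  by have -> : limn (series z) = (lr +i* li : C) by apply: cvg_lim => //;
    exact: norm_hausdorff.
apply: cvg_ReIm => /=.
- by apply: cvg_trans hr; rewrite /series /=; under eq_fun do rewrite Re_sum.
- by apply: cvg_trans hi; rewrite /series /=; under eq_fun do rewrite Im_sum.
Qed.

(** The bound does not depend on [n], which is what dominated convergence asks of the partial sums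
    of the kernel. *)
Lemma norm_series_le z (b : nat -> R) n :
  (forall n, Normc.normc (z n) <= b n) -> cvgn (series b) ->
  Normc.normc (series z n) <= limn (series b).
Proof.
move=> zb cb.
have b0 k : 0 <= b k by exact: le_trans (normc_ge0 _) (zb k).
apply: le_trans (nondecreasing_cvgn_le _ cb n); last first.
  by apply/nondecreasing_seqP => m; rewrite -[in leRHS]addn1 /series /= addn1
    big_nat_recr //= lerDl.
rewrite /series /=.
elim: n => [|n IH]; first by rewrite !big_geq // Normc.normc0.
rewrite !big_nat_recr //=; apply: le_trans (le_normcD _ _) _.
exact: lerD.
Qed.

End ComplexLimits.

(** * Bounds and convergence of q-shifted factorials *)

Section QPochhammer.
Context {R : realType}.
Variable q : R.
Hypotheses (q0 : 0 < q) (q1 : q < 1).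

Lemma qpochSr (K : numFieldType) (p a : K) n :
  qpoch p a n.+1 = qpoch p a n * (1 - a * p ^+ n).
Proof. by rewrite /qpoch big_ord_recr. Qed.

Lemma qpoch0 (K : numFieldType) (p a : K) : qpoch p a 0 = 1.
Proof. by rewrite /qpoch big_ord0. Qed.

Let qn0 n : 0 < q ^+ n. Proof. exact: exprn_gt0. Qed.
Let qn1 n : q ^+ n <= 1. Proof. by rewrite exprn_ile1 // ltW. Qed.

(** Closed form of [1 + q + ... + q^(n-1)]; it is the exponent that accumulates when each factor of
    a product is compared with an exponential. *)
Definition geom_sum n : R := (1 - q ^+ n) / (1 - q).

Lemma geom_sum0 : geom_sum 0 = 0.
Proof. by rewrite /geom_sum expr0 subrr mul0r. Qed.

Lemma geom_sumS n : geom_sum n.+1 = geom_sum n + q ^+ n.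
Proof.
have h : 1 - q != 0 by rewrite gt_eqF // subr_gt0.
by rewrite /geom_sum exprSr; field.
Qed.

Lemma geom_sum_le n : geom_sum n <= (1 - q)^-1.
Proof.
rewrite /geom_sum ler_piMl ?invr_ge0 ?subr_ge0 ?(ltW q1) //.
by rewrite gerBl ltW.
Qed.

Definition qpoch_lb (b : R) : R := expR (- ((1 - b)^-1 * (1 - q)^-1)).

Lemma qpoch_lb_gt0 b : 0 < qpoch_lb b.
Proof. exact: expR_gt0. Qed.

(** With [y = q^j], each factor satisfies [1/(1 - a y) <= 1 + y/(1-b) <= exp(y/(1-b))]. Multiplying
    over [j] puts the geometric sum, at most [1/(1-q)], in the exponent. The bound is uniform in [n]
    and in [a <= b]. *)
Lemma qpoch_ge_lb (a b : R) n : 0 <= a -> a <= b -> b < 1 ->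
  qpoch_lb b <= qpoch q a n.
Proof.
move=> a0 ab b1.
have b1' : 0 < 1 - b by rewrite subr_gt0.
apply: (@le_trans _ _ (expR (- ((1 - b)^-1 * geom_sum n)))).
  by rewrite ler_expR lerN2 ler_wpM2l ?geom_sum_le // invr_ge0 ltW.
elim: n => [|n IH]; first by rewrite geom_sum0 mulr0 oppr0 expR0 qpoch0.
rewrite qpochSr geom_sumS mulrDr opprD expRD ler_pM ?expR_ge0 //.
rewrite expRN invf_ple ?posrE ?expR_gt0 //; last first.
  rewrite subr_gt0 (le_lt_trans _ b1) // (le_trans _ ab) //.
  by rewrite ler_piMr.
apply: le_trans (expR_ge1Dx _).
set y := q ^+ n.
have y0 : 0 < y by exact: qn0.
have y1 : y <= 1 by exact: qn1.
have ay : a * y <= b by rewrite (le_trans _ ab) // ler_piMr.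
have ay1 : 0 < 1 - a * y by rewrite subr_gt0 (le_lt_trans ay).
rewrite -div1r ler_pdivrMr //.
have -> : (1 + (1 - b)^-1 * y) * (1 - a * y) =
  1 + y * (1 - b)^-1 * (1 - a * (1 - b) - a * y).
  by field; rewrite gt_eqF.
rewrite lerDl mulr_ge0 ?mulr_ge0 ?invr_ge0 ?(ltW y0) ?(ltW b1') //.
(* Since [a y <= b], the remaining factor is at least [(1 - a)(1 - b)]. *)
nra.
Qed.

Lemma qpoch_ge0 (a : R) n : 0 <= a -> a <= 1 -> 0 <= qpoch q a n.
Proof.
move=> a0 a1; apply: prodr_ge0 => i _.
by rewrite subr_ge0 mulr_ile1 // ltW.
Qed.

Lemma qpoch_le1 (a : R) n : 0 <= a -> a <= 1 -> qpoch q a n <= 1.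
Proof.
move=> a0 a1; elim: n => [|n IH]; first by rewrite qpoch0.
by rewrite qpochSr mulr_ile1 ?qpoch_ge0 ?subr_ge0 ?mulr_ile1 ?(ltW (qn0 _))
  // gerBl mulr_ge0 // ltW.
Qed.

Lemma qpoch_cvg (a : R) : 0 <= a -> a <= 1 -> qpoch q a @ \oo --> qpoch_inf q a.
Proof.
move=> a0 a1; apply: nonincreasing_is_cvgn.
  apply/nonincreasing_seqP => n; rewrite qpochSr.
  by rewrite ler_piMr ?qpoch_ge0 // gerBl mulr_ge0 // ltW.
by exists 0 => _ [n _ <-]; exact: qpoch_ge0.
Qed.

Lemma qpoch_inf_ge0 (a : R) : 0 <= a -> a <= 1 -> 0 <= qpoch_inf q a.
Proof.
move=> a0 a1; apply: limr_ge; first exact: qpoch_cvg.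
by near=> n; exact: qpoch_ge0.
Unshelve. all: by end_near. Qed.

Lemma qpoch_inf_le1 (a : R) : 0 <= a -> a <= 1 -> qpoch_inf q a <= 1.
Proof.
move=> a0 a1; apply: limr_le; first exact: qpoch_cvg.
by near=> n; exact: qpoch_le1.
Unshelve. all: by end_near. Qed.

Lemma qpoch_inf_ge_lb (a b : R) : 0 <= a -> a <= b -> b < 1 ->
  qpoch_lb b <= qpoch_inf q a.
Proof.
move=> a0 ab b1; apply: limr_ge.
  by apply: qpoch_cvg => //; rewrite (le_trans ab) // ltW.
by near=> n; exact: qpoch_ge_lb.
Unshelve. all: by end_near. Qed.

Lemma normc_cis (phi : R) : Normc.normc (cis phi) = 1.
Proof. by rewrite /= cos2Dsin2 sqrtr1. Qed.

Lemma normc_real (x : R) : Normc.normc x%:C = `|x|.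
Proof. by rewrite /= expr0n /= addr0 sqrtr_sqr. Qed.

(** Each factor has modulus at most [1 + q^j <= exp(q^j)]. *)
Lemma normc_qpoch_le (a : R[i]) n : Normc.normc a <= 1 ->
  Normc.normc (qpoch q%:C a n) <= expR (1 - q)^-1.
Proof.
move=> a1; apply: (@le_trans _ _ (expR (geom_sum n))); last first.
  by rewrite ler_expR geom_sum_le.
elim: n => [|n IH]; first by rewrite geom_sum0 expR0 qpoch0 Normc.normc1.
rewrite qpochSr geom_sumS expRD Normc.normcM ler_pM ?normc_ge0 //.
apply: le_trans (le_normcD _ _) _.
rewrite Normc.normc1 normcN Normc.normcM -(rmorphXn (real_complex R)) normc_real
  ger0_norm ?(ltW (qn0 _)) //.
by apply: le_trans (expR_ge1Dx _); rewrite lerD2l ler_piMl // ltW.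
Qed.

Lemma qpochc_cvg (a : R[i]) : Normc.normc a <= 1 ->
  qpoch q%:C a @ \oo --> qpoch_inf q%:C a.
Proof.
move=> a1.
suff h : cvgn (series (telescope (qpoch q%:C a))).
  suff : cvgn (qpoch q%:C a) by [].
  have -> : qpoch q%:C a = (fun n => 1 + series (telescope (qpoch q%:C a)) n).
    by apply/funext => n; rewrite [LHS]eq_sum_telescope qpoch0.
  by apply: is_cvgD h; exact: is_cvg_cst.
apply/cvg_ex; eexists; apply: (@series_cvg_to_sum _ _
  (geometric (expR (1 - q)^-1) q)).
  move=> n; rewrite /telescope /= qpochSr mulrBr mulr1 addrAC subrr add0r normcN.
  rewrite 2!Normc.normcM -(rmorphXn (real_complex R)) normc_real ger0_norm
    ?(ltW (qn0 _)) //.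
  rewrite ler_pM ?mulr_ge0 ?normc_ge0 ?(ltW (qn0 _)) //;
    first exact: normc_qpoch_le.
  by rewrite ler_piMl // ltW.
by apply: is_cvg_geometric_series; rewrite ger0_norm // ltW.
Qed.

(** Partial product of [|1 - r q^j e^(i phi)|^2], written with real quantities only. *)
Definition qpoch_sqr (r phi : R) n : R :=
  \prod_(j < n) (1 - 2 * (r * q ^+ j) * cos phi + (r * q ^+ j) ^+ 2).

Lemma qpoch_sqrE (r phi : R) n :
  qpoch q%:C (r%:C * cis phi) n * qpoch q%:C (r%:C * cis (- phi)) n =
  (qpoch_sqr r phi n)%:C.
Proof.
rewrite /qpoch -big_split /= /qpoch_sqr rmorph_prod /=.
apply: eq_bigr => j _; rewrite -rmorphXn /cis cosN sinN; simpc.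
apply/eqP; rewrite eq_complex /=; apply/andP; split; apply/eqP; last by ring.
by have := cos2Dsin2 phi; move: (cos _) (sin _) => c s h; nra.
Qed.

(** The product of the two conjugate limits is the limit of the real numbers [qpoch_sqr r phi n].
    Its imaginary part is a limit of zeros, so it is real and equals the real limit. *)
Lemma qpoch_inf_sqr (r phi : R) : 0 <= r -> r <= 1 ->
  qpoch_inf q%:C (r%:C * cis phi) * qpoch_inf q%:C (r%:C * cis (- phi)) =
    (limn (qpoch_sqr r phi))%:C /\
  qpoch_sqr r phi @ \oo --> limn (qpoch_sqr r phi).
Proof.
move=> r0 r1.
have n1 psi : Normc.normc (r%:C * cis psi) <= 1.
  by rewrite Normc.normcM normc_real normc_cis mulr1 ger0_norm.
set l := LHS.
have h : (fun n => (qpoch_sqr r phi n)%:C : (R[i] : numFieldType)) @ \oo --> l.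
  under eq_fun do rewrite -qpoch_sqrE.
  exact: cvgM (qpochc_cvg _ (n1 phi)) (qpochc_cvg _ (n1 (- phi))).
have [/= Er hi] := cvg_Re_Im _ _ h.
have El : complex.Im l = 0.
  by rewrite -(cvg_lim _ hi) //= lim_cst.
have E : limn (qpoch_sqr r phi) = complex.Re l by exact: cvg_lim.
rewrite E; split => //.
by case: (l) El => a b /= ->.
Qed.

Lemma qpoch_sqr_factor_ge (x phi : R) : 0 <= x ->
  (1 - x) ^+ 2 <= 1 - 2 * x * cos phi + x ^+ 2.
Proof. by move=> x0; have := cos_le1 phi; nra. Qed.

Lemma qpoch_sqr_ge (r phi : R) n : 0 <= r -> r < 1 ->
  qpoch_lb r ^+ 2 <= qpoch_sqr r phi n.
Proof.
move=> r0 r1; apply: (@le_trans _ _ (qpoch q r n ^+ 2)).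
  by rewrite lerXn2r ?nnegrE ?qpoch_ge0 ?(ltW r1) ?qpoch_ge_lb // ltW ?qpoch_lb_gt0.
rewrite /qpoch -prodrXl; apply: ler_prod => j _.
by rewrite sqr_ge0 qpoch_sqr_factor_ge // mulr_ge0 // ltW.
Qed.

Lemma qpoch_sqr_ge0 (r phi : R) n : 0 <= r -> 0 <= qpoch_sqr r phi n.
Proof.
move=> r0; apply: prodr_ge0 => j _.
apply: le_trans (sqr_ge0 _) (qpoch_sqr_factor_ge _ _ _).
by rewrite mulr_ge0 // ltW.
Qed.

(** The factor [j = 0] is exactly [2 - 2 cos phi] and is kept, since it later cancels the [1/sin] of
    the weight; hence the index [n.+1]. Every other factor is at most
    [(1 + q^j)^2 <= exp(2 q^j)]. *)
Lemma qpoch_sqr1_le (phi : R) n :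
  qpoch_sqr 1 phi n.+1 <= (2 - 2 * cos phi) * expR (2 * (1 - q)^-1).
Proof.
have c0 : 0 <= 2 - 2 * cos phi by have := cos_le1 phi; lra.
apply: (@le_trans _ _ ((2 - 2 * cos phi) * expR (2 * geom_sum n.+1))); last first.
  by rewrite ler_wpM2l // ler_expR ler_wpM2l // geom_sum_le.
elim: n => [|n IH].
  rewrite /qpoch_sqr big_ord_recr big_ord0 /= geom_sumS geom_sum0 expr0 add0r
    !mulr1 mul1r expr1n.
  have -> : 1 - 2 * cos phi + 1 = 2 - 2 * cos phi by ring.
  by rewrite ler_peMr // -expR0 ler_expR.
rewrite /qpoch_sqr big_ord_recr /= (geom_sumS n.+1) (mulrDr 2 (geom_sum _))
  expRD (mulrA (2 - _)).
apply: ler_pM => //.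
- exact: qpoch_sqr_ge0.
- apply: le_trans (sqr_ge0 _) (qpoch_sqr_factor_ge _ _ _).
  by rewrite mulr_ge0 // ltW.
- rewrite mul1r; set x := q ^+ n.+1.
  have x0 : 0 < x by exact: qn0.
  apply: (@le_trans _ _ ((1 + x) ^+ 2)).
    by have := cos_geN1 phi; nra.
  rewrite expRM_natl lerXn2r ?nnegrE ?expR_ge0 ?addr_ge0 ?(ltW x0) //.
  exact: expR_ge1Dx.
Qed.

End QPochhammer.

(** * The weight: real form, sign, upper bound and measurability on (-1,1) *)

Section Weight.
Context {R : realType}.
Variables q nu : R.
Hypotheses (q0 : 0 < q) (q1 : q < 1) (nu0 : 0 < nu).
Local Notation I11 := (`]-1, 1[%classic : set R).

Lemma powR_lt1 (p : R) : 0 < p -> q `^ p < 1.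
Proof.
move=> p0; rewrite /powR gt_eqF // -expR0 ltr_expR pmulr_rlt0 //.
by rewrite ln_lt0 // q0.
Qed.

Lemma powR_le1 (p : R) : 0 <= p -> q `^ p <= 1.
Proof.
by rewrite le_eqVlt => /predU1P[<-|/powR_lt1/ltW//]; rewrite powRr0.
Qed.

Definition qweight_const : R :=
  qpoch_inf q q * qpoch_inf q (q `^ (nu *+ 2)) /
  (pi *+ 2 * (qpoch_inf q (q `^ nu) * qpoch_inf q (q `^ (nu + 1)))).

Let nu2 : 0 < nu *+ 2. Proof. by rewrite mulrn_wgt0. Qed.
Let nu1 : 0 < nu + 1. Proof. by rewrite addr_gt0. Qed.

Lemma qweight_const_ge0 : 0 <= qweight_const.
Proof.
have h p : 0 < p -> 0 <= qpoch_inf q (q `^ p).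
  by move=> p0; rewrite qpoch_inf_ge0 ?powR_ge0 // powR_le1 // ltW.
have h' : 0 <= qpoch_inf q q by exact: (qpoch_inf_ge0 _ q0 q1 _ (ltW q0) (ltW q1)).
by rewrite /qweight_const divr_ge0 // mulr_ge0 ?h // ?mulr_ge0 ?h // mulrn_wge0
  // pi_ge0.
Qed.

(** For [0 <= r <= 1] this is [|(r e^(i phi); q)_oo|^2]. *)
Definition qpoch_sqr_inf (r phi : R) : R := limn (qpoch_sqr q r phi).

Lemma Re_real_div (a b c d : R) :
  complex.Re (a%:C * b%:C / (c%:C * d%:C)) = a * b / (c * d).
Proof. by rewrite -!rmorphM -fmorphV -rmorphM. Qed.

Lemma qpoch_inf_conj1 (phi : R) :
  qpoch_inf q%:C (cis phi) * qpoch_inf q%:C (cis (- phi)) =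
  (qpoch_sqr_inf 1 phi)%:C.
Proof.
by have [] := qpoch_inf_sqr _ q0 q1 1 phi ler01 (lexx _); rewrite !mul1r.
Qed.

(** The conjugate pairs collapse to squared moduli, so the argument of [Re] in [qweight] is already
    real and the weight becomes a quotient of real functions. *)
Lemma qweightE (x : R) : qweight q nu x = qweight_const *
  (qpoch_sqr_inf 1 (acos x *+ 2) /
   (sin (acos x) * qpoch_sqr_inf (q `^ nu) (acos x *+ 2))).
Proof.
have [E _] := qpoch_inf_sqr _ q0 q1 (q `^ nu) (acos x *+ 2) (powR_ge0 _ _)
  (powR_le1 _ (ltW nu0)).
transitivity (complex.Re
  ((qpoch_inf q q * qpoch_inf q (q `^ (nu *+ 2)))%:C *
    (qpoch_sqr_inf 1 (acos x *+ 2))%:C /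
   ((pi *+ 2 * sin (acos x) *
      (qpoch_inf q (q `^ nu) * qpoch_inf q (q `^ (nu + 1))))%:C *
    (qpoch_sqr_inf (q `^ nu) (acos x *+ 2))%:C))).
  congr (complex.Re (_ * _ / (_ * _))); first exact: qpoch_inf_conj1.
  exact: E.
rewrite Re_real_div /qweight_const.
(* Inverses distribute over products even at zero, so they can be generalised as atoms and [ring]
   needs no nonvanishing condition. *)
rewrite !invfM.
move: (qpoch_sqr_inf _ _) (qpoch_sqr_inf _ _)^-1 (sin _)^-1 => P Q' s'.
move: (qpoch_inf q _) (qpoch_inf q _) (qpoch_inf q _)^-1 (qpoch_inf q _)^-1
  (_ *+ 2)^-1 => a b c d p.
by ring.
Qed.

Lemma sin_acos_gt0 (x : R) : I11 x -> 0 < sin (acos x).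
Proof.
rewrite /= in_itv /= => /andP[x1 x2].
apply: sin_gt0_pi; rewrite acos_gt0 ?acos_ltpi ?(ltW x1) ?(ltW x2) //.
by rewrite x1.
Qed.

Lemma qpoch_sqr_inf_ge (r phi : R) : 0 <= r -> r < 1 ->
  qpoch_lb q r ^+ 2 <= qpoch_sqr_inf r phi.
Proof.
move=> r0 r1; apply: limr_ge.
  exact: (qpoch_inf_sqr _ q0 q1 r phi r0 (ltW r1)).2.
by near=> n; exact: qpoch_sqr_ge.
Unshelve. all: by end_near. Qed.

Lemma qpoch_sqr_inf1_ge0 (phi : R) : 0 <= qpoch_sqr_inf 1 phi.
Proof.
apply: limr_ge.
  exact: (qpoch_inf_sqr _ q0 q1 1 phi ler01 (lexx _)).2.
by near=> n; exact: qpoch_sqr_ge0.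
Unshelve. all: by end_near. Qed.

Lemma qpoch_sqr_inf1_le (theta : R) :
  qpoch_sqr_inf 1 (theta *+ 2) <= 4 * sin theta ^+ 2 * expR (2 * (1 - q)^-1).
Proof.
apply: limr_le.
  exact: (qpoch_inf_sqr _ q0 q1 1 _ ler01 (lexx _)).2.
near=> n.
(* The bound is for nonempty products, hence the restriction to [n >= 1]. With [phi = 2 theta] the
   first factor is [2 - 2 cos(2 theta) = 4 sin^2 theta]. *)
have -> : n = n.-1.+1 by rewrite prednK //; near: n; exists 1%N.
apply: le_trans (qpoch_sqr1_le _ q0 q1 _ _) _.
rewrite ler_wpM2r ?expR_ge0 // cos_mulr2n.
by have := cos2Dsin2 theta; move: (cos _) (sin _) => c s h; rewrite mulr2n; lra.
Unshelve. all: by end_near. Qed.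

Lemma qweight_ge0 (x : R) : I11 x -> 0 <= qweight q nu x.
Proof.
move=> Ix; rewrite qweightE mulr_ge0 ?qweight_const_ge0 // divr_ge0
  ?qpoch_sqr_inf1_ge0 //.
rewrite mulr_ge0 ?(ltW (sin_acos_gt0 _ Ix)) //.
by apply: le_trans (qpoch_sqr_inf_ge _ _ _ _); rewrite ?sqr_ge0 ?powR_ge0 ?powR_lt1.
Qed.

Definition qweight_ub : R :=
  qweight_const * (4 * expR (2 * (1 - q)^-1) / qpoch_lb q (q `^ nu) ^+ 2).

Lemma qweight_le (x : R) : I11 x -> qweight q nu x <= qweight_ub.
Proof.
move=> Ix; rewrite qweightE ler_wpM2l ?qweight_const_ge0 //.
have s0 := sin_acos_gt0 _ Ix.
have s1 : sin (acos x) <= 1 by exact: sin_le1.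
have lb0 : 0 < qpoch_lb q (q `^ nu) ^+ 2 by rewrite exprn_gt0 // qpoch_lb_gt0.
have F := qpoch_sqr_inf_ge (q `^ nu) (acos x *+ 2) (powR_ge0 _ _) (powR_lt1 _ nu0).
rewrite ler_pdivrMr; last by rewrite mulr_gt0 // (lt_le_trans lb0).
apply: le_trans (qpoch_sqr_inf1_le _) _.
set E := expR _; have E0 : 0 < E by exact: expR_gt0.
set s := sin _ in s0 s1 *; set L := _ ^+ 2 in lb0 F *;
  set P := qpoch_sqr_inf _ _ in F *.
(* After cancelling one [s], the claim is [s <= P / L], which holds because [s <= 1 <= P / L]. *)
have -> : 4 * E / L * (s * P) = 4 * E * s * (P / L) by field; rewrite gt_eqF.
rewrite (_ : 4 * s ^+ 2 * E = 4 * E * s * s); last by ring.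
rewrite ler_wpM2l ?mulr_ge0 ?(ltW E0) ?(ltW s0) //.
by apply: (le_trans s1); rewrite ler_pdivlMr // mul1r.
Qed.

Lemma measurable_acos : measurable_fun I11 (@acos R).
Proof.
apply: open_continuous_measurable_fun; first exact: interval_open.
by move=> x; rewrite inE /= in_itv /=; exact: continuous_acos.
Qed.

Lemma measurable_cos_acos (c : R) : measurable_fun I11 (fun x => cos (c * acos x)).
Proof.
apply: measurableT_comp; first by apply: continuous_measurable_fun;
  exact: continuous_cos.
by apply: measurable_funM => //; exact: measurable_acos.
Qed.

Lemma measurable_sin_acos (c : R) : measurable_fun I11 (fun x => sin (c * acos x)).
Proof.
apply: measurableT_comp; first by apply: continuous_measurable_fun;
  exact: continuous_sin.
by apply: measurable_funM => //; exact: measurable_acos.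
Qed.

Lemma measurable_qpoch_sqr_inf (r : R) : 0 <= r -> r <= 1 ->
  measurable_fun I11 (fun x => qpoch_sqr_inf r (acos x *+ 2)).
Proof.
move=> r0 r1.
apply: (@measurable_fun_cvg _ _ _ _ (fun n x => qpoch_sqr q r (acos x *+ 2) n));
  last first.
  by move=> x _; exact: (qpoch_inf_sqr _ q0 q1 r _ r0 r1).2.
elim => [|n IH].
  rewrite (_ : (fun _ => _) = cst 1); first exact: measurable_cst.
  by apply/funext => x; rewrite /qpoch_sqr big_ord0.
rewrite (_ : (fun _ => _) = (fun x => qpoch_sqr q r (acos x *+ 2) n *
  (1 - 2 * (r * q ^+ n) * cos (acos x *+ 2) + (r * q ^+ n) ^+ 2))); last first.
  by apply/funext => x; rewrite /qpoch_sqr big_ord_recr.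
apply: measurable_funM => //.
apply: measurable_funD => //; apply: measurable_funB => //.
apply: measurable_funM => //.
rewrite (_ : (fun _ => _) = (fun x => cos (2 * acos x)));
  first exact: measurable_cos_acos.
by apply/funext => x; rewrite mulr_natl.
Qed.

Lemma measurable_qweight : measurable_fun I11 (qweight q nu).
Proof.
have -> : qweight q nu = fun x => qweight_const *
  (qpoch_sqr_inf 1 (acos x *+ 2) *
   (sin (acos x) * qpoch_sqr_inf (q `^ nu) (acos x *+ 2))^-1).
  by apply/funext => x; rewrite qweightE.
apply: measurable_funM => //; apply: measurable_funM.
  exact: measurable_qpoch_sqr_inf.
(* On (-1,1) the denominator is nonnegative, so its inverse is the power with exponent [-1], and
   measurability of [powR] applies. *)
apply: (@eq_measurable_fun _ _ _ _ _ (fun x =>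
  (sin (acos x) * qpoch_sqr_inf (q `^ nu) (acos x *+ 2)) `^ (-1))).
  move=> x; rewrite inE => Ix; rewrite powR_inv1 // mulr_ge0
    ?(ltW (sin_acos_gt0 _ Ix)) //.
  by apply: le_trans (qpoch_sqr_inf_ge _ _ _ _);
    rewrite ?sqr_ge0 ?powR_ge0 ?powR_lt1.
apply: (measurableT_comp (measurable_powR _)).
apply: measurable_funM.
  rewrite (_ : (fun _ => _) = (fun x => sin (1 * acos x)));
    first exact: measurable_sin_acos.
  by apply/funext => x; rewrite mul1r.
by apply: measurable_qpoch_sqr_inf; rewrite ?powR_ge0 // powR_le1 // ltW.
Qed.

End Weight.

(** * Convergence of series with Gaussian decay *)

Section Summability.
Context {R : realType}.

Lemma fact_le_expn n : (n`! <= n ^ n)%N.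
Proof.
(* The base [n] stays fixed while the induction runs on [m]. *)
have h m : (m <= n -> m`! <= n ^ m)%N.
  elim: m => // m IH mn; rewrite factS expnS leq_mul //; exact: IH (ltnW mn).
exact: h.
Qed.

(** Comparison with the exponential series at [A/(1-p)]: from [n! <= n^n] and [n p^(n-1) <= 1/(1-p)]
    one gets [n! p^(n(n-1)) <= (n p^(n-1))^n <= (1-p)^(-n)]. *)
Lemma cvg_gaussian_series (A p : R) : 0 <= A -> 0 < p -> p < 1 ->
  cvgn (series (fun n => A ^+ n * p ^+ (n * n.-1))).
Proof.
move=> A0 p0 p1.
(* Each of the [n] terms of [1 + p + ... + p^(n-1)] is at least [p^(n-1)]. *)
have np n : n%:R * p ^+ n.-1 <= (1 - p)^-1.
  case: n => [|n] /=; first by rewrite mul0r invr_ge0 subr_ge0 ltW.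
  apply: le_trans (geom_sum_le _ p0 p1 n.+1).
  elim: n => [|n IH]; first by rewrite geom_sumS // geom_sum0 expr0 mul1r add0r.
  rewrite geom_sumS // -natr1 mulrDl mul1r lerD2r (le_trans _ IH) //.
  by rewrite ler_wpM2l // exprS ler_piMl ?exprn_ge0 // ltW.
apply: series_le_cvg (is_cvg_series_exp_coeff (A * (1 - p)^-1)) => n.
- by rewrite mulr_ge0 ?exprn_ge0 // ltW.
- by rewrite exp_coeff_ge0 // mulr_ge0 // invr_ge0 subr_ge0 ltW.
rewrite /exp_coeff /= ler_pdivlMr ?ltr0n ?fact_gt0 //.
rewrite exprMn -mulrA ler_wpM2l ?exprn_ge0 //.
rewrite mulnC exprM; apply: (@le_trans _ _ ((p ^+ n.-1) ^+ n * n%:R ^+ n)).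
  rewrite ler_wpM2l ?exprn_ge0 ?(ltW p0) // -natrX ler_nat; exact: fact_le_expn.
by rewrite -exprMn mulrC lerXn2r ?nnegrE ?invr_ge0 ?subr_ge0 ?(ltW p1) ?mulr_ge0
  ?exprn_ge0 ?(ltW p0).
Qed.

End Summability.

(** * Bounds on the polynomials, the q-Bessel functions and the kernel terms *)

Section Bounds.
Context {R : realType}.
Variables q nu : R.
Hypotheses (q0 : 0 < q) (q1 : q < 1) (nu0 : 0 < nu).

Let lb := qpoch_lb q q.
Let lb0 : 0 < lb. Proof. exact: qpoch_lb_gt0. Qed.

Lemma qpoch_pow_ge0 (p : R) n : 0 < p -> 0 <= qpoch q (q `^ p) n.
Proof. by move=> p0; rewrite qpoch_ge0 // ?powR_ge0 // powR_le1 // ltW. Qed.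

Lemma qpoch_pow_le1 (p : R) n : 0 < p -> qpoch q (q `^ p) n <= 1.
Proof. by move=> p0; rewrite qpoch_le1 // ?powR_ge0 // powR_le1 // ltW. Qed.

Lemma qpochqq_ge n : lb <= qpoch q q n.
Proof. exact: (qpoch_ge_lb _ q0 q1 _ _ _ (ltW q0) (lexx _) q1). Qed.

Lemma normc_sum (I : Type) (r : seq I) (F : I -> R[i]) :
  Normc.normc (\sum_(i <- r) F i) <= \sum_(i <- r) Normc.normc (F i).
Proof.
elim: r => [|i r IH]; first by rewrite !big_nil Normc.normc0.
by rewrite !big_cons (le_trans (le_normcD _ _)) // lerD2l.
Qed.

(** There are [n+1] exponentials of modulus 1; in their coefficients the numerators are at most 1
    and the denominators at least [lb^2]. No condition on [x] is needed, as the angle is real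
    anyway. *)
Lemma normc_qultra_le n (x : R) :
  Normc.normc (qultra (q `^ nu) q n x) <= n.+1%:R * (lb * lb)^-1.
Proof.
apply: le_trans (normc_sum _ _ _) _.
apply: (@le_trans _ _ (\sum_(j < n.+1) (lb * lb)^-1)); last first.
  by rewrite sumr_const card_ord [leRHS]mulr_natl.
apply: ler_sum => j _; rewrite Normc.normcM normc_cis mulr1 normc_real.
have h m : 0 < qpoch q q m by apply: lt_le_trans lb0 (qpochqq_ge m).
rewrite ger0_norm; last by rewrite divr_ge0 ?mulr_ge0 ?qpoch_pow_ge0 // ltW.
rewrite -[leRHS]mul1r ler_pM ?mulr_ge0 ?qpoch_pow_ge0 ?invr_ge0 ?mulr_ge0
  ?(ltW (h _)) //.
  by rewrite mulr_ile1 ?qpoch_pow_ge0 ?qpoch_pow_le1.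
by rewrite lef_pV2 ?posrE ?mulr_gt0 // ler_pM ?qpochqq_ge // ltW.
Qed.

(** The quarter matches the exponent [k(2 nu + k - 1)/4] of the kernel: real powers of [q] are
    compared with natural powers of this base. *)
Definition qroot4 : R := q `^ 4^-1.

Lemma qroot4_gt0 : 0 < qroot4. Proof. exact: powR_gt0. Qed.
Lemma qroot4_lt1 : qroot4 < 1. Proof. by apply: powR_lt1; rewrite // invr_gt0. Qed.

Lemma pow_qroot4 n : qroot4 ^+ n = q `^ (n%:R / 4).
Proof. by rewrite -powR_mulrn ?powR_ge0 // -powRrM mulrC. Qed.

Lemma powR_le_qroot4 n (y : R) : n%:R / 4 <= y -> q `^ y <= qroot4 ^+ n.
Proof. by move=> ny; rewrite pow_qroot4 ger_powR // q0 ltW. Qed.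

(** Replacing [t] by [max 1 t] makes the base positive, so that its power [nu + k + 2n] splits even
    at [t = 0]. The [k]-th power is left out here and kept as a separate factor. *)
Definition qbessel_ub (t : R) : R :=
  lb^-1 * (Num.max 1 t `^ nu * (lb * lb)^-1 *
  limn (series (fun n => (Num.max 1 t ^+ 2) ^+ n * qroot4 ^+ (n * n.-1)))).

Let T1 (t : R) : 1 <= Num.max 1 t. Proof. by rewrite le_max lexx. Qed.
Let T0 (t : R) : 0 <= Num.max 1 t. Proof. exact: le_trans ler01 (T1 t). Qed.

(** All estimates are uniform in [k] apart from the power [t^k]. The prefactor is at most [1/lb],
    and the series is dominated termwise by a Gaussian one. *)
Lemma normr_qbessel_le k (t : R) : 0 <= t ->
  `|qbessel q (nu + k%:R) (t *+ 2)| <= qbessel_ub t * Num.max 1 t ^+ k.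
Proof.
move=> t0.
have nuk : 0 < nu + k%:R by rewrite ltr_pwDl.
have nuk1 : 0 < nu + k%:R + 1 by rewrite ltr_wpDr.
rewrite /qbessel normrM /qbessel_ub -(mulrA lb^-1) ler_pM //.
  rewrite normrM normfV !ger0_norm ?qpoch_inf_ge0 ?powR_ge0 ?powR_le1
    ?(ltW nuk1) ?(ltW q0) ?(ltW q1) //.
  rewrite -[leRHS]mul1r ler_pM ?invr_ge0 ?qpoch_inf_ge0 ?powR_ge0 ?powR_le1
    ?(ltW nuk1) ?(ltW q0) ?(ltW q1) //.
    by rewrite qpoch_inf_le1 ?powR_ge0 ?powR_le1 ?(ltW nuk1).
  have h : lb <= qpoch_inf q q by exact: (qpoch_inf_ge_lb _ q0 q1 _ _ (ltW q0)
    (lexx _) q1).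
  by rewrite lef_pV2 ?posrE // (lt_le_trans lb0).
set g := fun n : nat => _ * qroot4 ^+ _.
set F := fun n : nat => _.
have cg : cvgn (series g).
  by apply: cvg_gaussian_series; rewrite ?exprn_ge0 ?qroot4_gt0 ?qroot4_lt1.
pose K := Num.max 1 t `^ nu * (lb * lb)^-1 * Num.max 1 t ^+ k.
have K0 : 0 <= K.
  by rewrite !mulr_ge0 ?powR_ge0 ?invr_ge0 ?mulr_ge0 ?exprn_ge0 ?(ltW lb0).
have cKg : cvgn (series (fun n => K * g n)) by exact: is_cvg_seriesZ.
have Fg n : `|F n| <= K * g n.
  rewrite /F /g !normrM normrX normrN1 expr1n mul1r normfV.
  have hq : 0 <= qpoch q (q `^ (nu + k%:R + 1)) n by exact: qpoch_pow_ge0.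
  (* As [q^(nu+k+1) <= q], the lower bound for [(q;q)_n] serves every order. *)
  have hl : lb <= qpoch q (q `^ (nu + k%:R + 1)) n.
    apply: (qpoch_ge_lb _ q0 q1 _ _ _ (powR_ge0 _ _) _ q1).
    by rewrite -[leRHS](powRr1 (ltW q0)) ger_powR ?q0 ?(ltW q1) // lerDr ltW.
  have hqq := qpochqq_ge n.
  rewrite normrM !ger0_norm ?powR_ge0 ?(le_trans (ltW lb0) hqq) //.
  have -> : K * (Num.max 1 t ^+ 2 ^+ n * qroot4 ^+ (n * n.-1)) =
      Num.max 1 t `^ nu * Num.max 1 t ^+ k * Num.max 1 t ^+ 2 ^+ n *
      (lb * lb)^-1 * qroot4 ^+ (n * n.-1).
    by rewrite /K; ring.
  apply: ler_pM; rewrite ?powR_ge0 ?divr_ge0 ?powR_ge0 ?mulr_ge0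
    ?(le_trans (ltW lb0) hqq) //; last first.
    (* The generous estimate [n(n-1)/4 <= n(nu + k + n)] suffices. *)
    apply: powR_le_qroot4.
    rewrite natrM -mulrA ler_wpM2l //.
    have : n.-1%:R <= n%:R :> R by rewrite ler_nat leq_pred.
    by have : 0 <= n.-1%:R :> R by []; lra.
  apply: ler_pM.
  - exact: powR_ge0.
  - by rewrite invr_ge0 mulr_ge0 // (le_trans (ltW lb0) hqq).
  - have -> : t *+ 2 / 2 = t by rewrite -[t *+ 2]mulr_natr mulfK.
    apply: (@le_trans _ _ (Num.max 1 t `^ (nu + k%:R + n%:R *+ 2))).
      rewrite ge0_ler_powR ?nnegrE //; first by rewrite addr_ge0 ?(ltW nuk)
        // mulrn_wge0.
      by rewrite le_max lexx orbT.
    rewrite -[n%:R *+ 2]mulr_natr -natrM.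
    rewrite !powRD ?(gt_eqF (lt_le_trans ltr01 (T1 t))) ?implybT //.
    by rewrite !powR_mulrn // mulnC exprM.
  - by rewrite lef_pV2 ?posrE ?mulr_gt0 ?(lt_le_trans lb0) // ler_pM // ltW.
have cF : cvgn [normed series F].
  by apply: series_le_cvg cKg => n /=; rewrite ?normr_ge0 //;
    exact: le_trans (normr_ge0 _) (Fg n).
apply: le_trans (lim_series_norm cF) _.
apply: le_trans (lim_series_le cF cKg Fg) _.
rewrite (lim_seriesZ K cg) /GRing.scale /= /K.
by rewrite mulrAC.
Qed.

Definition kernel_coef (t : R) (k : nat) : R[i] :=
  'i%C ^+ k *
    (q `^ (k%:R * (nu *+ 2 + k%:R - 1) / 4) *
     ((1 - q `^ (k%:R + nu)) / (1 - q `^ nu)) *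
     Num.sqrt (qpoch q q k / qpoch q (q `^ (nu *+ 2)) k) *
     qbessel q (nu + k%:R) (t *+ 2))%:C.

(** The [2] in the geometric part comes from [k + 1 <= 2^k], which absorbs the growth of the
    polynomials. *)
Definition kernel_ub (t : R) (k : nat) : R :=
  (1 - q `^ nu)^-1 * Num.sqrt (qpoch_lb q (q `^ (nu *+ 2)))^-1 * qbessel_ub t *
  (lb * lb)^-1 * ((2 * Num.max 1 t) ^+ k * qroot4 ^+ (k * k.-1)).

Lemma cvg_kernel_ub (t : R) : cvgn (series (kernel_ub t)).
Proof.
apply: is_cvg_seriesZ; apply: cvg_gaussian_series.
- by rewrite mulr_ge0.
- exact: qroot4_gt0.
- exact: qroot4_lt1.
Qed.

Lemma normc_i_pow n : Normc.normc ('i%C ^+ n : R[i]) = 1.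
Proof.
elim: n => [|n IH]; first by rewrite expr0 Normc.normc1.
by rewrite exprS Normc.normcM IH mulr1 /= expr0n add0r expr1n sqrtr1.
Qed.

Lemma normc_kernel_term_le (t x : R) k : 0 <= t ->
  Normc.normc (kernel_coef t k * qultra (q `^ nu) q k x) <= kernel_ub t k.
Proof.
move=> t0; rewrite 2!Normc.normcM normc_i_pow mul1r normc_real 4!normrM.
have nup : 0 < nu *+ 2 by rewrite mulrn_wgt0.
have b1 : q `^ nu < 1 by exact: powR_lt1.
have h1 : `|q `^ (k%:R * (nu *+ 2 + k%:R - 1) / 4)| <= qroot4 ^+ (k * k.-1).
  rewrite ger0_norm ?powR_ge0 //; apply: powR_le_qroot4.
  (* Dropping [2 nu] leaves [k(k-1)/4]; [k = 0] is separate because [k.-1] truncates. *)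
  rewrite ler_wpM2r ?invr_ge0 // natrM; case: k => [|k]; first by rewrite !mul0r.
  by rewrite ler_wpM2l // -natr1 /=; lra.
have h2 : `|1 - q `^ (k%:R + nu)| * `|(1 - q `^ nu)^-1| <= (1 - q `^ nu)^-1.
  rewrite [`|_^-1|]ger0_norm ?invr_ge0 ?subr_ge0 ?(ltW b1) //.
  rewrite ler_piMl ?invr_ge0 ?subr_ge0 ?(ltW b1) //.
  by rewrite ger0_norm ?gerBl ?powR_ge0 // subr_ge0 powR_le1 // addr_ge0 // ltW.
have h3 : `|Num.sqrt (qpoch q q k / qpoch q (q `^ (nu *+ 2)) k)| <=
    Num.sqrt (qpoch_lb q (q `^ (nu *+ 2)))^-1.
  rewrite ger0_norm ?sqrtr_ge0 // ler_wsqrtr //.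
  have h : qpoch_lb q (q `^ (nu *+ 2)) <= qpoch q (q `^ (nu *+ 2)) k.
    by apply: qpoch_ge_lb; rewrite ?powR_ge0 ?powR_lt1.
  have l0 : 0 < qpoch_lb q (q `^ (nu *+ 2)) by exact: qpoch_lb_gt0.
  rewrite -[leRHS]mul1r ler_pM ?invr_ge0 ?qpoch_pow_ge0 ?qpoch_ge0 ?(ltW q0)
    ?(ltW q1) //.
    by rewrite qpoch_le1 ?(ltW q0) ?(ltW q1).
  by rewrite lef_pV2 ?posrE // (lt_le_trans l0).
have h4 := normr_qbessel_le k _ t0.
have h5 := normc_qultra_le k x.
have h6 : k.+1%:R <= 2 ^+ k :> R by rewrite -natrX ler_nat ltn_expl.
(* Regrouped to follow the order of the factors on the left, so that each use of [ler_pM] consumes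
   one of the bounds above. *)
have -> : kernel_ub t k = qroot4 ^+ (k * k.-1) * (1 - q `^ nu)^-1 *
  Num.sqrt (qpoch_lb q (q `^ (nu *+ 2)))^-1 * (qbessel_ub t * Num.max 1 t ^+ k) *
  (2 ^+ k * (lb * lb)^-1).
  by rewrite /kernel_ub exprMn; ring.
apply: ler_pM => //; rewrite ?mulr_ge0 ?normc_ge0 //.
  apply: ler_pM => //; rewrite ?mulr_ge0 //.
  apply: ler_pM => //; rewrite ?mulr_ge0 //.
  by apply: ler_pM => //; rewrite ?mulr_ge0 //.
by apply: (le_trans h5); rewrite ler_wpM2r // invr_ge0 mulr_ge0 // ltW.
Qed.

Lemma kernel_cvg (t x : R) : 0 <= t ->
  series_cvg_to (fun k => kernel_coef t k * qultra (q `^ nu) q k x)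
    (qkernel q nu x t).
Proof.
move=> t0; apply: series_cvg_to_sum (cvg_kernel_ub t) => n.
exact: normc_kernel_term_le.
Qed.

End Bounds.

(** * Integration of complex-valued functions by components *)

Section Integration.
Context {R : realType}.
Local Notation I11 := (`]-1, 1[%classic : set R).
Local Notation mu := (@lebesgue_measure R).
Implicit Types (f g : R -> R[i]).

Let mI : measurable I11. Proof. exact: measurable_itv. Qed.

Definition cmeasurable f :=
  measurable_fun I11 (fun x => complex.Re (f x)) /\
  measurable_fun I11 (fun x => complex.Im (f x)).

Definition cintegrable f :=
  mu.-integrable I11 (EFin \o (fun x => complex.Re (f x))) /\
  mu.-integrable I11 (EFin \o (fun x => complex.Im (f x))).

Lemma integrableZl_fin (k : R) (h : R -> R) : mu.-integrable I11 (EFin \o h) ->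
  mu.-integrable I11 (EFin \o (fun x => k * h x)).
Proof. by move=> ih; apply: (@integrableZl _ _ R mu I11 _ k (EFin \o h)). Qed.

Lemma integrableD_fin (h k : R -> R) :
  mu.-integrable I11 (EFin \o h) -> mu.-integrable I11 (EFin \o k) ->
  mu.-integrable I11 (EFin \o (fun x => h x + k x)).
Proof. by move=> ih ik; apply: (@integrableD _ _ R mu I11 _ (EFin \o h)
  (EFin \o k)). Qed.

Lemma le_integrable_fin (h k : R -> R) : measurable_fun I11 h ->
  (forall x, I11 x -> `|h x| <= k x) ->
  mu.-integrable I11 (EFin \o k) -> mu.-integrable I11 (EFin \o h).
Proof.
move=> mh hk ik; apply: (@le_integrable _ _ _ mu I11 mI _ (EFin \o k)) => //.
  exact/measurable_EFinP.
by move=> x Ix /=; rewrite lee_fin (le_trans (hk x Ix)) // ler_norm.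
Qed.

Lemma ReD (a b : R[i]) : complex.Re (a + b) = complex.Re a + complex.Re b.
Proof. by case: a b => ? ? []. Qed.

Lemma ImD (a b : R[i]) : complex.Im (a + b) = complex.Im a + complex.Im b.
Proof. by case: a b => ? ? []. Qed.

Lemma Re_mulr_real (a : R[i]) (r : R) : complex.Re (a * r%:C) = complex.Re a * r.
Proof. by case: a => a b /=; rewrite mulr0 subr0. Qed.

Lemma Im_mulr_real (a : R[i]) (r : R) : complex.Im (a * r%:C) = complex.Im a * r.
Proof. by case: a => a b /=; rewrite mulr0 add0r. Qed.

Lemma cintegralD f g : cintegrable f -> cintegrable g ->
  cintegral (fun x => f x + g x) = cintegral f + cintegral g.
Proof.
move=> [fr fi] [gr gi]; rewrite /cintegral; apply/eqP; rewrite eq_complex /=.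
rewrite -!RintegralD //.
apply/andP; split; apply/eqP; apply: eq_Rintegral => x _.
  by case: (f x) (g x) => ? ? [].
by case: (f x) (g x) => ? ? [].
Qed.

Lemma cintegralZ (c : R[i]) f : cintegrable f ->
  cintegral (fun x => c * f x) = c * cintegral f.
Proof.
move=> [fr fi]; case: c => a b; rewrite /cintegral; apply/eqP;
  rewrite eq_complex /=.
rewrite -!RintegralZl //.
rewrite -RintegralB //; [|exact: integrableZl_fin..].
rewrite -RintegralD //; [|exact: integrableZl_fin..].
apply/andP; split; apply/eqP; apply: eq_Rintegral => x _.
  by case: (f x).
by case: (f x) => ? ? /=; rewrite addrC.
Qed.

Lemma cintegrable0 : cintegrable (fun _ => 0).
Proof. by split; exact: integrable0. Qed.

Lemma cintegral0 : cintegral (fun _ : R => 0) = 0.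
Proof. by rewrite /cintegral /= /Rintegral integral0. Qed.

Lemma cintegrableD f g : cintegrable f -> cintegrable g ->
  cintegrable (fun x => f x + g x).
Proof.
move=> [fr fi] [gr gi]; split.
  rewrite (_ : (fun x => _) = (fun x => complex.Re (f x) + complex.Re (g x)));
    last first.
    by apply/funext => x; rewrite ReD.
  exact: integrableD_fin.
rewrite (_ : (fun x => _) = (fun x => complex.Im (f x) + complex.Im (g x)));
  last first.
  by apply/funext => x; rewrite ImD.
exact: integrableD_fin.
Qed.

Lemma cintegral_sum (F : nat -> R -> R[i]) n :
  (forall k, cintegrable (F k)) ->
  cintegral (fun x => \sum_(0 <= k < n) F k x) = \sum_(0 <= k < n) cintegral (F k).
Proof.
move=> hF.
(* Additivity needs integrability of the partial sum, so both are carried through the induction. *)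
suff [] : cintegrable (fun x => \sum_(0 <= k < n) F k x) /\
  cintegral (fun x => \sum_(0 <= k < n) F k x) = \sum_(0 <= k < n) cintegral
    (F k) by [].
elim: n => [|n [IH1 IH2]].
  rewrite (_ : (fun _ => _) = (fun => 0)); last by apply/funext => x;
    rewrite big_geq.
  by rewrite big_geq // cintegral0; split => //; exact: cintegrable0.
rewrite (_ : (fun _ => _) = (fun x => \sum_(0 <= k < n) F k x + F n x)); last first.
  by apply/funext => x; rewrite big_nat_recr.
by rewrite big_nat_recr //= cintegralD // IH2; split => //; exact: cintegrableD.
Qed.

Lemma cmeasurable_sum (F : nat -> R -> R[i]) n :
  (forall k, cmeasurable (F k)) -> cmeasurable (fun x => \sum_(0 <= k < n) F k x).
Proof.
move=> hF; split.
  rewrite (_ : (fun _ => _) = (fun x => \sum_(0 <= k < n) complex.Re (F k x))).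
    by apply: measurable_sum => k; exact: (hF k).1.
  by apply/funext => x; rewrite Re_sum.
rewrite (_ : (fun _ => _) = (fun x => \sum_(0 <= k < n) complex.Im (F k x))).
  by apply: measurable_sum => k; exact: (hF k).2.
by apply/funext => x; rewrite Im_sum.
Qed.

Lemma cmeasurableM f g : cmeasurable f -> cmeasurable g ->
  cmeasurable (fun x => f x * g x).
Proof.
move=> [fr fi] [gr gi]; split.
  rewrite (_ : (fun _ => _) = (fun x => complex.Re (f x) * complex.Re (g x) -
    complex.Im (f x) * complex.Im (g x))); last first.
    by apply/funext => x; case: (f x) (g x) => ? ? [].
  by apply: measurable_funB; apply: measurable_funM.
rewrite (_ : (fun _ => _) = (fun x => complex.Re (f x) * complex.Im (g x) +
  complex.Im (f x) * complex.Re (g x))); last first.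
  by apply/funext => x; case: (f x) (g x) => ? ? [].
by apply: measurable_funD; apply: measurable_funM.
Qed.

Lemma cmeasurable_cst (c : R[i]) : cmeasurable (fun _ => c).
Proof. by split; exact: measurable_cst. Qed.

Lemma cmeasurable_qultra (b q : R) n : cmeasurable (qultra b q n).
Proof.
pose c (j : 'I_n.+1) : R :=
  (qpoch q b j * qpoch q b (n - j)) / (qpoch q q j * qpoch q q (n - j)).
split.
  rewrite (_ : (fun _ => _) =
    (fun x => \sum_(j < n.+1) c j * cos ((n%:R - j%:R *+ 2) * acos x))).
    apply: measurable_sum => j.
    by apply: measurable_funM => //; exact: measurable_cos_acos.
  by apply/funext => x; rewrite /qultra Re_sum; apply: eq_bigr => j _;
    rewrite /= mul0r subr0.
rewrite (_ : (fun _ => _) =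
  (fun x => \sum_(j < n.+1) c j * sin ((n%:R - j%:R *+ 2) * acos x))).
  apply: measurable_sum => j.
  by apply: measurable_funM => //; exact: measurable_sin_acos.
by apply/funext => x; rewrite /qultra Im_sum; apply: eq_bigr => j _;
  rewrite /= mul0r addr0.
Qed.

(** With [a = u x] and [b] a bounded factor, this gives one real dominating function for both
    components. *)
Lemma mul_ReIm_le (a b : R[i]) (C : R) : Normc.normc b <= C ->
  `|complex.Re (a * b)| <= (`|complex.Re a| + `|complex.Im a|) * C /\
  `|complex.Im (a * b)| <= (`|complex.Re a| + `|complex.Im a|) * C.
Proof.
move=> bC.
have br := le_trans (Re_le_normc b) bC; have bi := le_trans (Im_le_normc b) bC.
case: a b br bi {bC} => a a' [b b'] /= br bi; split.
  by rewrite mulrDl (le_trans (ler_normB _ _)) // !normrM lerD // ler_wpM2l.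
by rewrite mulrDl (le_trans (ler_normD _ _)) // !normrM lerD // ler_wpM2l.
Qed.

(** Dominated convergence is applied to the extended-real integrals; [fine] carries the limit back
    to [R] because the integral of [G] is finite. *)
Lemma cvg_Rintegral_dominated (F : nat -> R -> R) (G H : R -> R) :
  (forall n, measurable_fun I11 (F n)) ->
  (forall x, F n x @[n --> \oo] --> G x) ->
  mu.-integrable I11 (EFin \o H) ->
  (forall n x, I11 x -> `|F n x| <= H x) ->
  Rintegral mu I11 (F n) @[n --> \oo] --> Rintegral mu I11 G.
Proof.
move=> mF FG iH FH.
have mG : measurable_fun I11 G by apply: measurable_fun_cvg mF _ => x _; exact: FG.
have [iG _ h] : [/\ mu.-integrable I11 (EFin \o G),
    [sequence (\int[mu]_(x in I11) `|(F n x)%:E - (G x)%:E|)%E]_n @ \oo --> 0%E &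
    [sequence (\int[mu]_(x in I11) (F n x)%:E)%E]_n @ \oo -->
      (\int[mu]_(x in I11) (G x)%:E)%E].
  apply: (@dominated_convergence _ _ R mu I11 _ (fun n => EFin \o F n)
    (EFin \o G) (EFin \o H)) => //.
  - by move=> n; apply/measurable_EFinP; exact: mF.
  - exact/measurable_EFinP.
  - by apply: aeW => x _; apply: cvg_EFin; [exact: nearW|exact: FG].
  - by apply: aeW => x n Ix; rewrite /= lee_fin FH.
apply: fine_cvg; rewrite /Rintegral fineK //.
exact: integrable_fin_num.
Qed.

(** * Integrals of [u] times a bounded function against the weight *)

Section Weighted.
Variables (q nu : R) (u : R -> R[i]).
Hypotheses (q0 : 0 < q) (q1 : q < 1) (nu0 : 0 < nu) (hu : in_H q nu u).
Local Notation w := (qweight q nu).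

Lemma in_H_cmeasurable : cmeasurable u.
Proof. by case: hu. Qed.

(* [|u| <= 1 + |u|^2], and both [w] and [|u|^2 w] are integrable. *)
Lemma integrable_in_H :
  mu.-integrable I11 (EFin \o (fun x => (`|complex.Re (u x)| + `|complex.Im
    (u x)|) * w x)).
Proof.
have [mr mi fin] := hu.
have mw : measurable_fun I11 w by exact: measurable_qweight.
have sqE x : Normc.normc (u x) ^+ 2 = complex.Re (u x) ^+ 2 + complex.Im (u x) ^+ 2.
  by case: (u x) => a b /=; rewrite sqr_sqrtr // addr_ge0 ?sqr_ge0.
have mu2 : measurable_fun I11 (fun x => Normc.normc (u x) ^+ 2 * w x).
  rewrite (_ : (fun _ => _) =
    (fun x => (complex.Re (u x) ^+ 2 + complex.Im (u x) ^+ 2) * w x)).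
    by apply: measurable_funM => //; apply: measurable_funD; exact: measurable_funX.
  by apply/funext => x; rewrite sqE.
have i1 : mu.-integrable I11 (EFin \o (fun x => Normc.normc (u x) ^+ 2 * w x)).
  apply/integrableP; split; first exact/measurable_EFinP.
  apply: le_lt_trans fin; rewrite le_eqVlt; apply/orP; left; apply/eqP.
  apply: eq_integral => x; rewrite inE => Ix /=.
  by rewrite ger0_norm // mulr_ge0 ?sqr_ge0 //; exact: qweight_ge0.
have i2 : mu.-integrable I11 (EFin \o cst (qweight_ub q nu)).
  apply/integrableP; split; first exact/measurable_EFinP.
  rewrite /= integral_cst //= lebesgue_measure_itv /=; case: ifP => _.
    by rewrite -EFinB -EFinM ltry.
  by rewrite mule0.
apply: le_integrable_fin (integrableD_fin _ _ i2 i1).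
  by apply: measurable_funM => //; apply: measurable_funD; exact: measurableT_comp.
move=> x Ix /=; have w0 := qweight_ge0 _ _ q0 q1 nu0 _ Ix.
have wb := qweight_le _ _ q0 q1 nu0 _ Ix.
rewrite ger0_norm ?mulr_ge0 ?addr_ge0 //.
apply: (@le_trans _ _ ((1 + Normc.normc (u x) ^+ 2) * w x)); last first.
  by rewrite mulrDl mul1r lerD2r.
rewrite ler_wpM2r // sqE -[complex.Re _ ^+ 2]real_normK ?num_real //.
rewrite -[complex.Im _ ^+ 2]real_normK ?num_real //.
set a := `|complex.Re _|; set b := `|complex.Im _|.
(* Completing both squares gives [a + b <= a^2 + b^2 + 1/2]. *)
have := sqr_ge0 (a - 2^-1); have := sqr_ge0 (b - 2^-1); nra.
Qed.

Lemma cintegrable_in_H (v : R -> R[i]) (C : R) : cmeasurable v ->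
  (forall x, Normc.normc (v x) <= C) ->
  cintegrable (fun x => u x * v x * (w x)%:C).
Proof.
move=> mv vC.
have mw : cmeasurable (fun x => (w x)%:C).
  by split; [exact: measurable_qweight|exact: measurable_cst].
have [mr mi] := cmeasurableM _ _ (cmeasurableM _ _ in_H_cmeasurable mv) mw.
have C0 : 0 <= C by exact: le_trans (normc_ge0 _) (vC 0).
split; apply: le_integrable_fin (integrableZl_fin C _ integrable_in_H) => //.
- move=> x Ix /=; have w0 := qweight_ge0 _ _ q0 q1 nu0 _ Ix.
  rewrite Re_mulr_real normrM (ger0_norm w0) mulrA ler_wpM2r // [leRHS]mulrC.
  by have [] := mul_ReIm_le (u x) _ _ (vC x).
- move=> x Ix /=; have w0 := qweight_ge0 _ _ q0 q1 nu0 _ Ix.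
  rewrite Im_mulr_real normrM (ger0_norm w0) mulrA ler_wpM2r // [leRHS]mulrC.
  by have [] := mul_ReIm_le (u x) _ _ (vC x).
Qed.

(** Both components of the integrand are dominated by [C (|Re u| + |Im u|) w], integrable and
    independent of [n]. *)
Lemma cvg_cintegral (v_ : nat -> R -> (R[i] : numFieldType))
    (v : R -> (R[i] : numFieldType)) (C : R) :
  (forall n, cmeasurable (v_ n)) ->
  (forall n x, Normc.normc (v_ n x) <= C) ->
  (forall x, v_ n x @[n --> \oo] --> v x) ->
  (fun n => cintegral (fun x => u x * v_ n x * (w x)%:C)) @ \oo -->
    (cintegral (fun x => u x * v x * (w x)%:C) : (R[i] : numFieldType)).
Proof.
move=> mv vC vv.
have cv x : (fun n => u x * v_ n x * (w x)%:C : (R[i] : numFieldType)) @ \oo -->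
    (u x * v x * (w x)%:C : (R[i] : numFieldType)).
  by apply: cvgMl; apply: cvgMr; exact: vv.
have mw : cmeasurable (fun x => (w x)%:C).
  by split; [exact: measurable_qweight|exact: measurable_cst].
have mF n := cmeasurableM _ _ (cmeasurableM _ _ in_H_cmeasurable (mv n)) mw.
have iH := integrableZl_fin C _ integrable_in_H.
apply: cvg_ReIm => /=.
- apply: cvg_Rintegral_dominated iH _.
  + by move=> n; exact: (mF n).1.
  + by move=> x; exact: (cvg_Re_Im _ _ (cv x)).1.
  + move=> n x Ix /=; have w0 := qweight_ge0 _ _ q0 q1 nu0 _ Ix.
    rewrite Re_mulr_real normrM (ger0_norm w0) mulrA ler_wpM2r // [leRHS]mulrC.
    by have [] := mul_ReIm_le (u x) _ _ (vC n x).
- apply: cvg_Rintegral_dominated iH _.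
  + by move=> n; exact: (mF n).2.
  + by move=> x; exact: (cvg_Re_Im _ _ (cv x)).2.
  + move=> n x Ix /=; have w0 := qweight_ge0 _ _ q0 q1 nu0 _ Ix.
    rewrite Im_mulr_real normrM (ger0_norm w0) mulrA ler_wpM2r // [leRHS]mulrC.
    by have [] := mul_ReIm_le (u x) _ _ (vC n x).
Qed.

End Weighted.

End Integration.

(** The factor [q^(n(2 nu + n - 1)/4)] and the argument [2t] are those of the kernel: integrating it
    term by term leaves them beside [a n], so the expansion is in these scaled functions rather than
    in bare [J_{nu+n}(t;q)]. The range [0 <= t] is where the real powers in [qbessel] have their
    intended meaning. *)
Theorem theorem5 (R : realType) (q nu : R) (hq0 : 0 < q) (hq1 : q < 1)
    (hnu : 0 < nu) (u : R -> R[i]) (hu : in_H q nu u) (f : R -> R[i])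
    (hf : forall t : R, 0 <= t ->
      f t = cintegral (fun x => u x * qkernel q nu x t * (qweight q nu x)%:C))
    (a : nat -> R[i])
    (ha : forall n : nat,
      a n = 'i%C ^+ n *
            ((1 - q `^ (n%:R + nu)) / (1 - q `^ nu) *
             Num.sqrt (qpoch q q n / qpoch q (q `^ (nu *+ 2)) n))%:C *
            cintegral (fun x =>
              u x * qultra (q `^ nu) q n x * (qweight q nu x)%:C)) :
  forall t : R, 0 <= t ->
    series_cvg_to
      (fun n => a n *
        (q `^ (n%:R * (nu *+ 2 + n%:R - 1) / 4) *
         qbessel q (nu + n%:R) (t *+ 2))%:C)
      (f t).
Proof.
move=> t t0; rewrite hf // /series_cvg_to.
pose c := kernel_coef q nu t.
pose C k := qultra (q `^ nu) q k.
have Cu k : cintegrable (fun x => u x * C k x * (qweight q nu x)%:C).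
  apply: cintegrable_in_H => //; first exact: cmeasurable_qultra.
  by move=> x; exact: normc_qultra_le.
have uE n x : u x * series (fun k => c k * C k x) n * (qweight q nu x)%:C =
    \sum_(0 <= k < n) c k * (u x * C k x * (qweight q nu x)%:C).
  by rewrite /series /= mulr_sumr mulr_suml; apply: eq_bigr => k _; ring.
have cu k : cintegrable (fun x => c k * (u x * C k x * (qweight q nu x)%:C)).
  rewrite (_ : (fun _ => _) = fun x => u x * (c k * C k x) * (qweight q nu x)%:C).
    apply: cintegrable_in_H => //.
      by apply: cmeasurableM; [exact: cmeasurable_cst|exact: cmeasurable_qultra].
    by move=> x; exact: normc_kernel_term_le.
  by apply/funext => x; ring.
(* Each partial sum of the expansion is the integral of [u] against a partial sum of the kernel, so
   only the passage to the limit remains; the finite identity is checked afterwards. *)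
rewrite (_ : series _ = fun n => cintegral
    (fun x => u x * series (fun k => c k * C k x) n * (qweight q nu x)%:C)).
  apply: cvg_cintegral => //.
  - move=> n; apply: cmeasurable_sum => k.
    by apply: cmeasurableM; [exact: cmeasurable_cst|exact: cmeasurable_qultra].
  - move=> n x; apply: (norm_series_le _ (kernel_ub q nu t));
    last exact: cvg_kernel_ub.
    by move=> k; exact: normc_kernel_term_le.
  - by move=> x; exact: kernel_cvg.
apply/funext => n; rewrite (_ : (fun _ => _) = fun x =>
  \sum_(0 <= k < n) c k * (u x * C k x * (qweight q nu x)%:C)); last first.
  by apply/funext => x; exact: uE.
rewrite cintegral_sum // /series /=; apply: eq_bigr => k _.
rewrite cintegralZ // ha /c /kernel_coef !rmorphM /=; ring.
Qed.
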